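(* Let $M$ be a matroid and let $\mathcal X$ be a zero-nonzero pattern such that $\mathcal X^T$ is the fundamental pattern of $M$. Then $M$ has no adjoint if and only if $\operatorname{mr}\mathcal R(\mathcal X)>\operatorname{tri}(\mathcal X)$.
   Context: The fundamental pattern of a matroid $M$ is the $\{0,*\}$-matrix with one row for each hyperplane of $M$ and one column for each element of $E(M)$, whose entry in row $H$, column $e$ is $0$ if and only if $e\in H$. For a pattern $\mathcal Y$, the zero set of a row is the set of column labels where it has entry $0$; $\mathcal R(\mathcal Y)$ is the set of matroids on the set of column labels of $\mathcal Y$ in which the zero set of every row is a flat; $\operatorname{mr}\mathcal R(\mathcal Y)$ is the smallest rank of a matroid in it. A square pattern is a triangle if its rows and columns can be permuted independently to give a lower triangular pattern with all diagonal entries $*$; $\operatorname{tri}(\mathcal Y)$ is the largest $k$ such that some $k\times k$ submatrix is a triangle. A simple matroid $M'$ is an adjoint of $M$ if $r(M')=r(M)$ and there is a map $\phi$ from the lattice of flats of $M$ to that of $M'$ which is injective, inclusion-reversing ($F_1\subseteq F_2\Rightarrow \phi(F_2)\subseteq\phi(F_1)$), and restricts to a bijection from the hyperplanes of $M$ onto the rank-$1$ flats of $M'$. *)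

(* Defs.v *)
From HB Require Import structures.
From mathcomp Require Import all_boot all_fingroup.

Set Implicit Arguments.
Unset Strict Implicit.
Unset Printing Implicit Defensive.

(* The axioms are boolean so that the matroids on a finite ground set form a
   finite type. *)
Definition matroid_axiom (E : finType) (I : {set {set E}}) : bool :=
  [&& set0 \in I,
      [forall A : {set E}, forall B : {set E},
         (B \in I) && (A \subset B) ==> (A \in I)]
    & [forall A in I, forall B in I,
         (#|A| < #|B|) ==> [exists x in B :\: A, x |: A \in I]]].

Record matroid (E : finType) : Type := Matroid {
  indep : {set {set E}};
  indepP : matroid_axiom indep
}.

HB.instance Definition _ (E : finType) := [isSub for @indep E].
HB.instance Definition _ (E : finType) := [Finite of matroid E by <:].

Definition rk (E : finType) (M : matroid E) (A : {set E}) : nat :=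
  \max_(B in indep M | B \subset A) #|B|.

Definition rank (E : finType) (M : matroid E) : nat := rk M setT.

Definition cl (E : finType) (M : matroid E) (A : {set E}) : {set E} :=
  [set x | rk M (x |: A) == rk M A].

Definition is_flat (E : finType) (M : matroid E) (F : {set E}) : bool :=
  cl M F == F.

(* In rank 0 there is no hyperplane. *)
Definition is_hyperplane (E : finType) (M : matroid E) (H : {set E}) : bool :=
  is_flat M H && ((rk M H).+1 == rank M).

Definition flat (E : finType) (M : matroid E) : finType :=
  {F : {set E} | is_flat M F}.

Definition hyperplane (E : finType) (M : matroid E) : finType :=
  {H : {set E} | is_hyperplane M H}.

Definition loop (E : finType) (M : matroid E) (x : E) : bool :=
  [set x] \notin indep M.

Definition parallel (E : finType) (M : matroid E) (x y : E) : bool :=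
  [&& x != y, ~~ loop M x, ~~ loop M y & [set x; y] \notin indep M].

Definition simple (E : finType) (M : matroid E) : Prop :=
  (forall x, ~~ loop M x) /\ (forall x y, ~~ parallel M x y).

(* The image condition says that phi maps the hyperplanes of M onto the rank-1
   flats of M'; since phi is injective, this restriction is a bijection. *)
Definition is_adjoint (E E' : finType) (M : matroid E) (M' : matroid E')
    : Prop :=
  [/\ simple M', rank M' = rank M
    & exists phi : flat M -> flat M',
      [/\ injective phi,
          (forall F1 F2 : flat M,
             val F1 \subset val F2 -> val (phi F2) \subset val (phi F1))
        & phi @: [set H : flat M | is_hyperplane M (val H)]
          = [set P : flat M' | rk M' (val P) == 1]]].

Definition has_adjoint (E : finType) (M : matroid E) : Prop :=
  exists (E' : finType) (M' : matroid E'), is_adjoint M M'.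

(* Zero-nonzero patterns with row labels R and column labels C; true stands
   for the entry *, false for the entry 0. *)
Definition pattern (R C : finType) : Type := {ffun R * C -> bool}.

Definition tr_pattern (R C : finType) (Y : pattern R C) : pattern C R :=
  [ffun p => Y (p.2, p.1)].

Definition fundamental_pattern (E : finType) (M : matroid E)
    : pattern (hyperplane M) E :=
  [ffun p : hyperplane M * E => p.2 \notin val p.1].

Definition zero_set (R C : finType) (Y : pattern R C) (r : R) : {set C} :=
  [set c | ~~ Y (r, c)].

(* The class R(Y). *)
Definition flat_matroids (R C : finType) (Y : pattern R C)
    : {set matroid C} :=
  [set M : matroid C | [forall r, is_flat M (zero_set Y r)]].

Lemma free_matroid_subproof (E : finType) :
  matroid_axiom [set: {set E}].
Proof.
apply/and3P; split; first by rewrite inE.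
  by apply/forallP => A; apply/forallP => B; rewrite !inE implybT.
apply/forall_inP => A _; apply/forall_inP => B _; apply/implyP => ltAB.
have /subsetPn [x xB xA] : ~~ (B \subset A).
  by apply: contraL ltAB => /subset_leq_card; rewrite leqNgt.
by apply/exists_inP; exists x; rewrite !inE ?xA.
Qed.

Definition free_matroid (E : finType) : matroid E :=
  Matroid (free_matroid_subproof E).

Lemma rk_free (E : finType) (A : {set E}) : rk (free_matroid E) A = #|A|.
Proof.
apply/eqP; rewrite eqn_leq; apply/andP; split.
  by apply/bigmax_leqP => B /andP [_]; apply: subset_leq_card.
rewrite /rk; apply: (@leq_bigmax_cond _ _ (fun B : {set E} => #|B|)).
by rewrite inE subxx.
Qed.

Lemma free_matroid_flat (R C : finType) (Y : pattern R C) :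
  free_matroid C \in flat_matroids Y.
Proof.
rewrite inE; apply/forallP => r; apply/eqP/setP => x.
rewrite inE !rk_free cardsU1 -[X in _ == X]add0n eqn_add2r eqb0.
exact: negbK.
Qed.

Lemma mr_subproof (R C : finType) (Y : pattern R C) :
  exists k, [exists M in flat_matroids Y, rank M == k].
Proof.
exists (rank (free_matroid C)); apply/exists_inP.
by exists (free_matroid C); first exact: free_matroid_flat.
Qed.

Definition mr (R C : finType) (Y : pattern R C) : nat :=
  ex_minn (mr_subproof Y).

Definition is_triangle (k : nat) (Z : pattern 'I_k 'I_k) : bool :=
  [exists s : 'S_k, exists t : 'S_k,
     [forall i, Z (s i, t i)] &&
     [forall i : 'I_k, forall j : 'I_k, (i < j) ==> ~~ Z (s i, t j)]].

(* f and g list k row labels and k column labels; has_triangle requires both to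
   be injective. *)
Definition submatrix (R C : finType) (Y : pattern R C) (k : nat)
    (f : {ffun 'I_k -> R}) (g : {ffun 'I_k -> C}) : pattern 'I_k 'I_k :=
  [ffun p => Y (f p.1, g p.2)].

Definition has_triangle (R C : finType) (Y : pattern R C) (k : nat) : bool :=
  [exists f : {ffun 'I_k -> R}, exists g : {ffun 'I_k -> C},
     [&& injectiveb f, injectiveb g & is_triangle (submatrix Y f g)]].

Lemma has_triangle_exists (R C : finType) (Y : pattern R C) :
  exists k, has_triangle Y k.
Proof.
exists 0; apply/existsP; exists (ffun0 (card_ord 0)).
apply/existsP; exists (ffun0 (card_ord 0)); apply/and3P; split.
- by apply/injectiveP; case.
- by apply/injectiveP; case.
- apply/existsP; exists 1%g; apply/existsP; exists 1%g.
  by apply/andP; split; apply/forallP; case.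
Qed.

Lemma has_triangle_bound (R C : finType) (Y : pattern R C) (k : nat) :
  has_triangle Y k -> k <= #|R|.
Proof.
case/existsP => f /existsP [g /and3P [/injectiveP injf _ _]].
by rewrite -[k in k <= _]card_ord; apply: leq_card injf.
Qed.

Definition tri (R C : finType) (Y : pattern R C) : nat :=
  ex_maxn (has_triangle_exists Y) (@has_triangle_bound _ _ Y).

(* Main.v *)
Require Import Defs.
From mathcomp Require Import all_boot.
From mathcomp Require Import fingroup perm zify.

(** Write [r] for the rank of [M].  A triangle in the pattern of [M] is a
    sequence of elements, each outside the closure of its predecessors, so
    [tri X = r]; read from the other end it is an independent sequence of
    hyperplanes in any matroid of [R(X)], so [mr X >= r].  It remains to see
    that [M] has an adjoint iff [R(X)] contains a matroid [N] of rank at most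
    [r].

    Such an [N] is itself an adjoint, via [F |-> {H | F \subset H}], which is an
    intersection of zero sets of rows.  Conversely, let [phi] define an adjoint
    [M'].  Maximal chains force [rk (phi F) = r - rk F], and hyperplanes become
    points of [M'], so [M'] can be pulled back to the hyperplanes of [M].  The
    zero set of row [e] is then the preimage of the flat [phi (cl e)], provided
    [phi] also reflects the incidence [e \in H]; this is
    [adjoint_point_notin]. *)

Set Implicit Arguments.
Unset Strict Implicit.
Unset Printing Implicit Defensive.

Definition mk_flat (E : finType) (M : matroid E) (F : {set E})
    (Ff : is_flat M F) : flat M := exist (fun F => is_true (is_flat M F)) F Ff.

Definition mk_hyperplane (E : finType) (M : matroid E) (H : {set E})
    (Hh : is_hyperplane M H) : hyperplane M :=
  exist (fun H => is_true (is_hyperplane M H)) H Hh.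

(** The zero set of row [e] when the transposed pattern is the fundamental one. *)
Definition hyperplanes_through (E : finType) (M : matroid E) (e : E)
    : {set hyperplane M} := [set H : hyperplane M | e \in val H].

(** * Rank, closure, flats and hyperplanes from the independence axioms *)

Section MatroidTheory.

Variables (E : finType) (M : matroid E).
Implicit Types (A B F J S : {set E}) (x : E).

Lemma indep0 : set0 \in indep M.
Proof. by case/and3P: (indepP M). Qed.

Lemma indepS A B : A \subset B -> B \in indep M -> A \in indep M.
Proof.
case/and3P: (indepP M) => _ /forallP /(_ A) /forallP /(_ B) /implyP h _.
by move=> sAB BI; apply: h; rewrite BI.
Qed.

Lemma indep_augment A B : A \in indep M -> B \in indep M -> #|A| < #|B| ->
  exists2 x, x \in B :\: A & x |: A \in indep M.
Proof.
case/and3P: (indepP M) => _ _ /forall_inP h AI BI ltAB.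
move/forall_inP: (h A AI) => /(_ B BI) /implyP /(_ ltAB).
by case/exists_inP=> x xBA xAI; exists x.
Qed.

Lemma indep_leq_rk A B : A \in indep M -> A \subset B -> #|A| <= rk M B.
Proof.
move=> AI sAB; rewrite /rk.
by apply: (@leq_bigmax_cond _ _ (fun B : {set E} => #|B|)); rewrite AI.
Qed.

Lemma rk_basis A : exists2 B, B \in indep M /\ B \subset A & #|B| = rk M A.
Proof.
have [|B] := @eq_bigmax_cond _ [pred B in indep M | B \subset A]
  (fun B : {set E} => #|B|).
  by apply/card_gt0P; exists set0; rewrite inE indep0 sub0set.
by case/andP=> BI sBA eqB; exists B => //; rewrite -eqB.
Qed.

Lemma rkS A B : A \subset B -> rk M A <= rk M B.
Proof.
move=> sAB; have [J [JI sJA] <-] := rk_basis A.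
exact: indep_leq_rk (subset_trans sJA sAB).
Qed.

Lemma rk_leq_card A : rk M A <= #|A|.
Proof. by apply/bigmax_leqP => B /andP [_]; apply: subset_leq_card. Qed.

Lemma rk_leq_rank A : rk M A <= rank M.
Proof. exact: rkS (subsetT _). Qed.

Lemma rk_indep A : A \in indep M -> rk M A = #|A|.
Proof.
by move=> AI; apply/eqP; rewrite eqn_leq rk_leq_card indep_leq_rk.
Qed.

Lemma indep_extend J A : J \in indep M -> #|J| < rk M A ->
  exists2 x, x \in A :\: J & x |: J \in indep M.
Proof.
move=> JI; have [B [BI sBA] <-] := rk_basis A => lt.
have [x /setDP [xB xJ] xI] := indep_augment JI BI lt.
by exists x => //; rewrite inE xJ (subsetP sBA).
Qed.

Lemma basis_extend J A : J \in indep M -> J \subset A ->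
  exists2 B, B \in indep M /\ J \subset B & B \subset A /\ #|B| = rk M A.
Proof.
have [n] := ubnP (rk M A - #|J|); elim: n J => // n IHn J lt JI sJA.
have [ltJ | geJ] := ltnP #|J| (rk M A); last first.
  exists J; split=> //; apply/eqP; rewrite eqn_leq geJ.
  by rewrite -(rk_indep JI) rkS.
have [x /setDP [xA xJ] xI] := indep_extend JI ltJ.
have [|//||B [BI sB] [sBA eqB]] := IHn (x |: J).
- by rewrite cardsU1 xJ; lia.
- by rewrite subUset sub1set xA.
by exists B => //; split=> //; apply: subset_trans sB; apply: subsetUr.
Qed.

Lemma sub_cl A : A \subset cl M A.
Proof.
by apply/subsetP => x xA; rewrite inE (setUidPr _) // sub1set.
Qed.

Lemma notin_cl A x : (x \notin cl M A) = (rk M A < rk M (x |: A)).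
Proof. by rewrite inE eqn_leq (rkS (subsetUr _ _)) andbT ltnNge. Qed.

(** Deleting [x] from a basis of [x |: A] leaves an independent subset of [A], so the rank rises by
    at most one. *)
Lemma notin_cl_rk A x : x \notin cl M A -> rk M (x |: A) = (rk M A).+1.
Proof.
rewrite notin_cl => lt; apply/eqP; rewrite eqn_leq lt andbT.
have [B [BI sB] <-] := rk_basis (x |: A).
have DI : B :\ x \in indep M by apply: indepS BI; apply: subD1set.
have := indep_leq_rk DI (B := A).
rewrite subDset sB => /(_ isT); rewrite [in #|B| <= _](cardsD1 x).
by case: (x \in B); lia.
Qed.

Lemma indepU1 J x : J \in indep M -> x \notin cl M J -> x |: J \in indep M.
Proof.
move=> JI; rewrite notin_cl (rk_indep JI) => lt.
have [y /setDP []] := indep_extend JI lt.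
by rewrite in_setU1 => /orP [/eqP -> | ->].
Qed.

(** A basis of [A] extends to one of [B]. An element that enlarges the larger basis also enlarges
    the smaller one, since independence passes to subsets. *)
Lemma clS A B : A \subset B -> cl M A \subset cl M B.
Proof.
move=> sAB; apply/subsetP => x; apply: contraLR => xB.
have [J [JI sJA] eqJ] := rk_basis A.
have [K [KI sJK] [sKB eqK]] := basis_extend JI (subset_trans sJA sAB).
have xnB : x \notin B by apply: contra xB; apply/subsetP/sub_cl.
rewrite notin_cl -eqK in xB.
(* [K] is a basis of [B], so the element extending it inside [x |: B] can only be [x]. *)
have [y /setDP [yxB yK] yI] := indep_extend KI xB.
have eyx : y = x.
  move: yxB; rewrite in_setU1 => /orP [/eqP // | yB].
  have := indep_leq_rk yI (B := B).
  by rewrite subUset sub1set yB sKB cardsU1 yK -eqK ltnn => /(_ isT).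
rewrite eyx in yK yI.
rewrite notin_cl -eqJ.
have xJI : x |: J \in indep M by apply: indepS yI; apply: setUS.
have := indep_leq_rk xJI (setUS _ sJA); rewrite cardsU1.
by rewrite (contra (subsetP sJK x) yK).
Qed.

Lemma rk_cl A : rk M (cl M A) = rk M A.
Proof.
apply/eqP; rewrite eqn_leq (rkS (sub_cl A)) andbT leqNgt.
apply/negP; have [J [JI sJA] eqJ] := rk_basis A; rewrite -eqJ => lt.
have [y /setDP [ycl yJ] yI] := indep_extend JI lt.
have := indep_leq_rk yI (setUS [set y] sJA).
by move: ycl; rewrite inE => /eqP ->; rewrite -eqJ cardsU1 yJ ltnn.
Qed.

Lemma cl_is_flat A : is_flat M (cl M A).
Proof.
rewrite /is_flat eqEsubset sub_cl andbT; apply/subsetP => x.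
apply: contraLR; rewrite !notin_cl rk_cl => /leq_trans; apply.
by rewrite rkS // setUS // sub_cl.
Qed.

Lemma cl_sub_flat A F : is_flat M F -> A \subset F -> cl M A \subset F.
Proof. by move=> /eqP Ff sAF; rewrite -Ff clS. Qed.

Lemma is_flatI (I : finType) (P : pred I) (F : I -> {set E}) :
  (forall i, P i -> is_flat M (F i)) -> is_flat M (\bigcap_(i | P i) F i).
Proof.
move=> fF; rewrite /is_flat eqEsubset sub_cl andbT.
by apply/bigcapsP => i Pi; apply: cl_sub_flat; [exact: fF | exact: bigcap_inf].
Qed.

Lemma cl_eq_flat A F : is_flat M F -> A \subset F -> rk M F <= rk M A ->
  cl M A = F.
Proof.
move=> Ff sAF le; apply/eqP; rewrite eqEsubset cl_sub_flat //=.
apply/subsetP => x xF; apply: contraLR le; rewrite notin_cl -ltnNge.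
by move/leq_trans; apply; rewrite rkS // subUset sub1set xF.
Qed.

Lemma flat_rk_ltn A F : is_flat M A -> A \subset F -> A != F ->
  rk M A < rk M F.
Proof.
move=> Af sAF; apply: contra_neqT; rewrite -leqNgt => le.
apply/eqP; rewrite eqEsubset sAF /=; apply/subsetP => x xF.
move/eqP: (Af) => <-; apply: contraLR le; rewrite notin_cl -ltnNge.
by move/leq_trans; apply; rewrite rkS // subUset sub1set xF.
Qed.

Lemma basis_notin_cl (B : {set E}) x : B \in indep M -> x \in B ->
  x \notin cl M (B :\ x).
Proof.
move=> BI xB; rewrite notin_cl setD1K // !rk_indep //.
  by rewrite [X in _ < X](cardsD1 x) xB.
by apply: indepS BI; apply: subD1set.
Qed.

(** Supplies, for each basis element, a hyperplane that avoids it and contains the rest of the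
    basis. The lower bounds on [tri] and on [mr] both use this family. *)
Lemma basis_hyperplane B x : B \in indep M -> #|B| = rank M -> x \in B ->
  is_hyperplane M (cl M (B :\ x)).
Proof.
move=> BI eqB xB; rewrite /is_hyperplane cl_is_flat rk_cl rk_indep /=.
  by rewrite -eqB [in X in _ == X](cardsD1 x) xB.
by apply: indepS BI; apply: subD1set.
Qed.

(** A basis of [F] extends first by [x], then to a basis of [M]; deleting [x] from the latter leaves
    a set spanning the required hyperplane. Hence a flat is the intersection of the hyperplanes
    containing it. *)
Lemma flat_avoiding_hyperplane F x : is_flat M F -> x \notin F ->
  exists H : hyperplane M, F \subset val H /\ x \notin val H.
Proof.
move=> Ff xF; have [J [JI sJF] eqJ] := rk_basis F.
have clJ : cl M J = F by apply: cl_eq_flat; rewrite // (rk_indep JI) eqJ.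
have xJI : x |: J \in indep M by apply: indepU1; rewrite ?clJ.
have [B [BI sB] [_ eqB]] := basis_extend xJI (subsetT _).
have xB : x \in B by apply: (subsetP sB); rewrite setU11.
exists (mk_hyperplane (basis_hyperplane BI eqB xB)) => /=; split.
  rewrite -clJ clS // subsetD1 (subset_trans (subsetUr _ _) sB) /=.
  by apply: contra xF => /(subsetP sJF).
exact: basis_notin_cl.
Qed.

Lemma hyperplane_avoids (H : hyperplane M) : exists x, x \notin val H.
Proof.
case: H => H /= /andP [_ /eqP rH]; apply/existsP; rewrite -negb_forall.
apply/negP => /forallP HT; have := ltnn (rank M).
by rewrite -[X in X < _]/(rk M setT) (_ : setT = H) ?rH ?leqnn //;
  apply/setP => x; rewrite inE HT.
Qed.

(** The flat [F i] contains all predecessors of [e i] but not [e i] itself, so each new element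
    raises the rank. Applied to elements of [M] and, dually, to hyperplanes of [M] as elements of a
    matroid in the class. *)
Lemma staircase_leq_rank k (e : 'I_k -> E) (F : 'I_k -> {set E}) :
  (forall i, is_flat M (F i)) -> (forall i, e i \notin F i) ->
  (forall i j : 'I_k, i < j -> e i \in F j) -> k <= rank M.
Proof.
move=> Ff eF eFlt.
suff h m : m <= k -> m <= rk M [set e i | i : 'I_k & i < m].
  exact: leq_trans (h k (leqnn k)) (rk_leq_rank _).
elim: m => [_|m IHm lt]; first exact: leq0n.
apply: leq_ltn_trans (IHm (ltnW lt)) _.
pose i := Ordinal lt.
set S := [set e i | i : 'I_k & i < m].
have : e i \notin cl M S.
  apply: contra (eF i); apply/subsetP/cl_sub_flat => //.
  by apply/subsetP => _ /imsetP [j jm ->]; rewrite inE in jm; apply: eFlt.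
rewrite notin_cl => /leq_trans; apply; apply: rkS.
rewrite subUset sub1set imset_f ?inE //=; apply/subsetP => _ /imsetP [j jm ->].
by rewrite inE in jm; rewrite imset_f // inE ltnW.
Qed.

(** * Simple matroids and their rank-1 flats *)

Lemma simple_cl1 x : simple M -> cl M [set x] = [set x].
Proof.
case=> nl np; apply/eqP; rewrite eqEsubset sub_cl andbT.
apply/subsetP => y; apply: contraLR; rewrite in_set1 => yx.
have I1 z : [set z] \in indep M by have := nl z; rewrite negbK.
have := np y x; rewrite /parallel yx !nl negbK /= => yxI.
by rewrite notin_cl [y |: _]/([set y; x]) !rk_indep // cards1 cards2 yx.
Qed.

Lemma simple_rk1_flat F : simple M -> is_flat M F -> rk M F = 1 ->
  exists x, F = [set x].
Proof.
move=> sM Ff rF; have [J [JI sJF]] := rk_basis F.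
rewrite rF => /eqP /cards1P [x eJ]; exists x; rewrite eJ in sJF JI.
by rewrite -(simple_cl1 x sM) (cl_eq_flat Ff) // rF rk_indep // cards1.
Qed.

Lemma simple_rk1 x : simple M -> rk M [set x] = 1.
Proof.
by case=> nl _; rewrite rk_indep ?cards1 //; have := nl x; rewrite negbK.
Qed.

(** Every flat contains all loops, and a flat containing [x] contains everything parallel to [x]. *)
Lemma separated_simple :
  (forall x, exists2 F, is_flat M F & x \notin F) ->
  (forall x y, x != y -> exists2 F, is_flat M F & (x \in F) && (y \notin F)) ->
  simple M.
Proof.
move=> h1 h2; have I1 x : [set x] \in indep M.
  have [F Ff xF] := h1 x; rewrite -[[set x]]setU0 indepU1 ?indep0 //.
  by apply: contra xF; apply/subsetP/cl_sub_flat; rewrite ?sub0set.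
split=> [x | x y]; rewrite ?negbK //.
apply/negP => /and4P [xy _ _ /negP []].
have [|F Ff /andP [yF xF]] := h2 y x; first by rewrite eq_sym.
apply: indepU1 => //; apply: contra xF; apply/subsetP/cl_sub_flat => //.
by rewrite sub1set.
Qed.

(** * Pullback of a matroid along an injection *)

Lemma preim_matroid_subproof (T : finType) (f : T -> E) (injf : injective f) :
  matroid_axiom [set A : {set T} | f @: A \in indep M].
Proof.
apply/and3P; split; first by rewrite inE imset0 indep0.
  apply/forallP => A; apply/forallP => B; apply/implyP; rewrite !inE.
  by case/andP => BI sAB; apply: indepS BI; apply: imsetS.
apply/forall_inP => A; rewrite inE => AI; apply/forall_inP => B.
rewrite inE => BI; apply/implyP => lt.
have [|_ /setDP [/imsetP [x xB ->] xA] xI] := indep_augment AI BI.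
  by rewrite !card_imset.
apply/exists_inP; exists x; last by rewrite inE imsetU1.
by rewrite inE xB andbT; apply: contra xA; apply: imset_f.
Qed.

Definition preim_matroid (T : finType) (f : T -> E) (injf : injective f) :
  matroid T := Matroid (preim_matroid_subproof injf).

End MatroidTheory.

Section PreimMatroid.

Variables (E T : finType) (M : matroid E) (f : T -> E) (injf : injective f).

Lemma rk_preim_matroid (A : {set T}) :
  rk (preim_matroid M injf) A = rk M (f @: A).
Proof.
apply/eqP; rewrite eqn_leq; apply/andP; split.
  have [B [BI sBA] <-] := rk_basis (preim_matroid M injf) A.
  rewrite inE in BI; rewrite -(card_imset _ injf).
  by apply: indep_leq_rk => //; apply: imsetS.
have [B [BI sBA] <-] := rk_basis M (f @: A).
have eB : B = f @: (f @^-1: B).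
  apply/setP => y; apply/idP/imsetP => [yB | [x]]; last by rewrite inE => ? ->.
  by have /imsetP [x xA yfx] := subsetP sBA y yB; exists x; rewrite // inE -yfx.
rewrite eB card_imset //; apply: indep_leq_rk; first by rewrite inE -eB.
apply/subsetP => x; rewrite inE => /(subsetP sBA) /imsetP [z zA] /injf.
by move=> ->.
Qed.

Lemma preim_flat (F : {set E}) :
  is_flat M F -> is_flat (preim_matroid M injf) (f @^-1: F).
Proof.
move=> Ff; rewrite /is_flat eqEsubset sub_cl andbT; apply/subsetP => x.
have sF : f @: (f @^-1: F) \subset F.
  by apply/subsetP => _ /imsetP [y yF ->]; rewrite inE in yF.
rewrite !inE !rk_preim_matroid imsetU1 => h.
by apply: (subsetP (cl_sub_flat Ff sF)); rewrite inE.
Qed.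

End PreimMatroid.

(** * Ranks and incidences under the map of an adjoint *)

Section Adjoint.

Variables (E E' : finType) (M : matroid E) (M' : matroid E').
Variable phi : flat M -> flat M'.
Hypotheses (inj_phi : injective phi) (rankM' : rank M' = rank M).
Hypothesis anti_phi : forall F1 F2 : flat M,
  val F1 \subset val F2 -> val (phi F2) \subset val (phi F1).

Definition flat_cl (A : {set E}) : flat M := mk_flat (cl_is_flat M A).

Lemma adjoint_rk_ltn (F1 F2 : flat M) : val F1 \subset val F2 -> F1 != F2 ->
  rk M' (val (phi F2)) < rk M' (val (phi F1)).
Proof.
move=> sF neF; apply: flat_rk_ltn; [exact: valP | exact: anti_phi |].
by apply: contra_neq neF => /val_inj /inj_phi.
Qed.

(** Climbing from [F] to the ground set in steps of rank one, the rank of the image drops by at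
    least one per step. *)
Lemma adjoint_rk_geq (F : flat M) :
  rank M <= rk M' (val (phi F)) + rk M (val F).
Proof.
have [n] := ubnP (rank M - rk M (val F)); elim: n F => // n IHn F lt.
have [eFT | neFT] := eqVneq (val F) setT; first by rewrite eFT leq_addl.
have /subsetPn [x _ xF] : ~~ (setT \subset val F) by rewrite subTset.
have /eqP clF := valP F; rewrite -clF in xF.
pose F' := flat_cl (x |: val F).
have rF' : rk M (val F') = (rk M (val F)).+1 by rewrite rk_cl notin_cl_rk.
have leF' := rk_leq_rank M (val F').
have : rk M' (val (phi F')) < rk M' (val (phi F)).
  apply: adjoint_rk_ltn; first exact: subset_trans (subsetUr _ _) (sub_cl _ _).
  by apply: contra_eq_neq rF' => <-; rewrite neq_ltn ltnSn.
have := IHn F'; lia.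
Qed.

(** Descending from [F] to a flat of rank 0, the rank of the image rises at each step, yet never
    exceeds [rank M'], which is [rank M]. *)
Lemma adjoint_rk_leq (F : flat M) :
  rk M' (val (phi F)) + rk M (val F) <= rank M.
Proof.
have [n] := ubnP (rk M (val F)); elim: n F => // n IHn F lt.
have [J [JI sJF] eqJ] := rk_basis M (val F).
have [J0 | [x xJ]] := set_0Vmem J.
  by rewrite -eqJ J0 cards0 addn0 -rankM' rk_leq_rank.
pose F' := flat_cl (J :\ x).
have DI : J :\ x \in indep M by apply: indepS JI; apply: subD1set.
have rF' : (rk M (val F')).+1 = rk M (val F).
  by rewrite rk_cl rk_indep // -eqJ (cardsD1 x J) xJ.
have : rk M' (val (phi F)) < rk M' (val (phi F')).
  apply: adjoint_rk_ltn.
    apply: cl_sub_flat; first exact: valP.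
    exact: subset_trans (subD1set _ _) sJF.
  by apply: contra_eq_neq rF' => ->; rewrite neq_ltn ltnSn orbT.
have := IHn F'; lia.
Qed.

Lemma adjoint_rk (F : flat M) : rk M' (val (phi F)) + rk M (val F) = rank M.
Proof. by apply/eqP; rewrite eqn_leq adjoint_rk_leq adjoint_rk_geq. Qed.

(* Downward induction on [J].  If [p] lies in [phi (cl (e, J))] but not in
   [phi (cl (e, x, J))] for an [x \in H] independent of [J], then these two
   span the former by rank; being also contained in [phi (cl (x, J))], which has
   the same rank, they force [cl (e, J) = cl (x, J)], although [e \notin H]. *)
Lemma adjoint_point_notin (H : flat M) (p : E') (e : E) (J : {set E}) :
  simple M' -> is_hyperplane M (val H) -> val (phi H) = [set p] ->
  e \notin val H -> J \in indep M -> J \subset val H ->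
  p \notin val (phi (flat_cl (e |: J))).
Proof.
move=> sM' hH pH eH; have /andP [Hf /eqP rH] := hH.
have [n] := ubnP (rank M - #|J|); elim: n J => // n IHn J lt JI sJH.
have eJcl (K : {set E}) : K \subset val H -> e \notin cl M K.
  by move=> sK; apply: contra eH; apply/subsetP/cl_sub_flat.
(* If [J] is a basis of [H], then [e |: J] spans [M], so the image of its closure has rank 0 and
   cannot contain the non-loop [p]. *)
have [ltJ | geJ] := ltnP #|J| (rk M (val H)); last first.
  have := adjoint_rk (flat_cl (e |: J)).
  rewrite rk_cl notin_cl_rk ?eJcl // (rk_indep JI) => hr.
  apply/negP => pF; have := @rkS _ M' [set p] (val (phi (flat_cl (e |: J)))).
  by rewrite sub1set pF simple_rk1 // => /(_ isT); lia.
have [x /setDP [xH xJ] xI] := indep_extend JI ltJ.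
have sxJ : x |: J \subset val H by rewrite subUset sub1set xH.
have {IHn} := IHn (x |: J); rewrite cardsU1 xJ => /(_ _ xI sxJ) => IH.
have {IH} pF' : p \notin val (phi (flat_cl (e |: (x |: J)))) by apply: IH; lia.
apply/negP => pF; set F := flat_cl (e |: J) in pF.
set F' := flat_cl (e |: (x |: J)) in pF'; pose G := flat_cl (x |: J).
have rF : rk M (val F) = #|J|.+1 by rewrite rk_cl notin_cl_rk ?eJcl // rk_indep.
have rG : rk M (val G) = #|J|.+1 by rewrite rk_cl rk_indep // cardsU1 xJ.
have rF' : rk M (val F') = #|J|.+2.
  by rewrite rk_cl notin_cl_rk ?eJcl // rk_indep // cardsU1 xJ.
have rS : (rk M' (val (phi F'))).+1 = rk M' (p |: val (phi F')).
  by rewrite notin_cl_rk //; have /eqP -> := valP (phi F').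
have rphi (K : flat M) : rk M (val K) = #|J|.+1 ->
    rk M' (val (phi K)) <= rk M' (p |: val (phi F')).
  move=> rK; rewrite -rS -(leq_add2r #|J|.+1) -{1}rK adjoint_rk addSnnS -rF'.
  by rewrite adjoint_rk.
have sF : p |: val (phi F') \subset val (phi F).
  rewrite subUset sub1set pF; apply: anti_phi; apply: clS.
  by apply: setUS; apply: subsetUr.
have sG : p |: val (phi F') \subset val (phi G).
  rewrite subUset -pH !anti_phi //; last exact: cl_sub_flat.
  by apply: clS; apply: subsetUr.
have e1 : cl M' (p |: val (phi F')) = val (phi F).
  by apply: cl_eq_flat => //; [exact: valP | exact: rphi].
have e2 : cl M' (p |: val (phi F')) = val (phi G).
  by apply: cl_eq_flat => //; [exact: valP | exact: rphi].
have /(congr1 val) /= eFG : F = G by apply/inj_phi/val_inj; rewrite -e1 -e2.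
have : e \in cl M (e |: J) by apply: (subsetP (sub_cl _ _)); rewrite setU11.
by rewrite eFG (negbTE (eJcl _ sxJ)).
Qed.

End Adjoint.

(** * Triangles of the pattern, and its matroids of small rank as adjoints *)

Section FundamentalPattern.

Variables (E : finType) (M : matroid E) (X : pattern E (hyperplane M)).
Hypothesis hX : tr_pattern X = fundamental_pattern M.

Lemma tr_fundamentalE e H : X (e, H) = (e \notin val H).
Proof. by move/ffunP: hX => /(_ (H, e)); rewrite !ffunE. Qed.

Lemma tr_fundamental_zero_set e : zero_set X e = hyperplanes_through M e.
Proof. by apply/setP => H; rewrite !inE tr_fundamentalE negbK. Qed.

(** In a triangle, the hyperplane of column [j] contains the elements of all earlier rows and avoids
    that of row [j]: a staircase in [M]. *)
Lemma tri_leq_rank : tri X <= rank M.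
Proof.
rewrite /tri; case: ex_maxnP => k /existsP [f /existsP [g]].
case/and3P => _ _ /existsP [s /existsP [t /andP [/forallP dg /forallP lw]]] _.
apply: (@staircase_leq_rank _ M k (fun i => f (s i)) (fun i => val (g (t i)))).
- by move=> i; have /andP [] := valP (g (t i)).
- by move=> i; have := dg i; rewrite ffunE tr_fundamentalE.
move=> i j ij; move/forallP: (lw i) => /(_ j) /implyP /(_ ij).
by rewrite ffunE tr_fundamentalE negbK.
Qed.

Lemma rank_leq_tri : rank M <= tri X.
Proof.
rewrite /tri; case: ex_maxnP => k _; apply.
have [B [BI _] eqB] := rk_basis M setT; rewrite /rank -eqB.
pose h (i : 'I_#|B|) : hyperplane M :=
  mk_hyperplane (basis_hyperplane BI eqB (enum_valP i)).
(* A basis and its hyperplanes give an identity submatrix, which is in particular a triangle. *)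
have XE i j : X (enum_val i, h j) = (i == j).
  rewrite tr_fundamentalE /=; have [<- | nij] := eqVneq i j.
    exact: basis_notin_cl (enum_valP i).
  apply/negbTE; rewrite negbK; apply: (subsetP (sub_cl _ _)).
  by rewrite !inE enum_valP andbT (inj_eq enum_val_inj).
apply/existsP; exists [ffun i => enum_val i].
apply/existsP; exists [ffun i => h i].
apply/and3P; split.
- by apply/injectiveP => i j; rewrite !ffunE => /enum_val_inj.
- apply/injectiveP => i j; rewrite !ffunE => eh.
  by apply/eqP; rewrite -XE -eh XE.
apply/existsP; exists 1%g; apply/existsP; exists 1%g; apply/andP; split.
  by apply/forallP => i; rewrite !ffunE !perm1 XE eqxx.
apply/forallP => i; apply/forallP => j; apply/implyP => ij.
by rewrite !ffunE !perm1 XE -val_eqE neq_ltn ij.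
Qed.

Lemma tri_fundamental : tri X = rank M.
Proof. by apply/eqP; rewrite eqn_leq tri_leq_rank rank_leq_tri. Qed.

Lemma flat_matroidsP (N : matroid (hyperplane M)) :
  reflect (forall e, is_flat N (hyperplanes_through M e))
          (N \in flat_matroids X).
Proof.
rewrite inE; apply: (iffP forallP) => h e.
  by rewrite -tr_fundamental_zero_set.
by rewrite tr_fundamental_zero_set.
Qed.

(** The staircase is now read in [N]: its elements are the hyperplanes of a basis of [M], its flats
    the zero sets of the basis rows. *)
Lemma rank_leq_flat_matroids (N : matroid (hyperplane M)) :
  N \in flat_matroids X -> rank M <= rank N.
Proof.
move/flat_matroidsP => fN; have [B [BI _] eqB] := rk_basis M setT.
rewrite /rank -eqB.
pose h (i : 'I_#|B|) : hyperplane M :=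
  mk_hyperplane (basis_hyperplane BI eqB (enum_valP i)).
apply: (staircase_leq_rank (e := h)
  (F := fun i => hyperplanes_through M (enum_val i))) => [i | i | i j ij].
- exact: fN.
- by rewrite inE; apply: basis_notin_cl (enum_valP i).
rewrite inE; apply: (subsetP (sub_cl _ _)).
by rewrite !inE enum_valP andbT (inj_eq enum_val_inj) -val_eqE neq_ltn ij orbT.
Qed.

Lemma flat_matroid_adjoint (N : matroid (hyperplane M)) :
  N \in flat_matroids X -> rank N <= rank M -> is_adjoint M N.
Proof.
move=> NX rN; have /flat_matroidsP fN := NX.
have sN : simple N.
  apply: separated_simple => [H | H1 H2 neH].
    have [e eH] := hyperplane_avoids H.
    by exists (hyperplanes_through M e); rewrite ?inE.
  (* Distinct hyperplanes are flats of equal rank, so neither contains the other. *)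
  have sH : ~~ (val H1 \subset val H2).
    apply: contra neH => sH; rewrite -val_eqE /=.
    have /andP [f1 /eqP r1] := valP H1; have /andP [f2 /eqP r2] := valP H2.
    have := @flat_rk_ltn _ _ (val H1) (val H2) f1 sH.
    by case: eqP => // _ /(_ isT); lia.
  have /subsetPn [e e1 e2] := sH.
  by exists (hyperplanes_through M e); rewrite ?inE ?e1.
split=> //; first by apply/eqP; rewrite eqn_leq rN rank_leq_flat_matroids.
(* If [F] is empty, the intersection is the whole ground set of [N]. *)
have phiP (F : flat M) :
    is_flat N (\bigcap_(e in val F) hyperplanes_through M e).
  exact: is_flatI.
pose phi (F : flat M) : flat N := mk_flat (phiP F).
have in_phi (F : flat M) (H : hyperplane M) :
    (H \in val (phi F)) = (val F \subset val H).
  apply/bigcapP/subsetP => h e eF; by have := h e eF; rewrite inE.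
(* Injectivity: a flat is determined by the hyperplanes containing it. *)
have sub_phi (F1 F2 : flat M) : val (phi F1) = val (phi F2) ->
    val F2 \subset val F1.
  move=> eF; apply/subsetP => x; apply: contraLR => xF.
  have [H [sH xH]] := flat_avoiding_hyperplane (valP F1) xF.
  by rewrite -in_phi eF in_phi in sH; apply: contra xH; apply/subsetP.
have phi_hyp (F : flat M) (hF : is_hyperplane M (val F)) :
    val (phi F) = [set mk_hyperplane hF].
  apply/setP => H; rewrite in_phi in_set1 -val_eqE /=.
  apply/idP/eqP => [sH | ->] //.
  have /andP [f1 /eqP r1] := hF; have /andP [f2 /eqP r2] := valP H.
  have := @flat_rk_ltn _ _ (val F) (val H) f1 sH.
  by case: eqP => // _ /(_ isT); lia.
exists phi; split.
- by move=> F1 F2 eF; apply/val_inj/eqP; rewrite eqEsubset !sub_phi // eF.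
- move=> F1 F2 sF; apply/subsetP => H; rewrite !in_phi.
  exact: subset_trans.
apply/setP => P; rewrite inE; apply/imsetP/eqP => [[F] | rP].
  by rewrite inE => hF ->; rewrite (phi_hyp _ hF) simple_rk1.
have [H eP] := simple_rk1_flat sN (valP P) rP.
have /andP [fH _] := valP H.
exists (mk_flat fH); first by rewrite inE; exact: (valP H).
apply: val_inj; rewrite (phi_hyp (mk_flat fH) (valP H)) eP; congr [set _].
exact: val_inj.
Qed.

Lemma adjoint_flat_matroid (E' : finType) (M' : matroid E') :
  is_adjoint M M' ->
  exists2 N : matroid (hyperplane M), N \in flat_matroids X & rank N <= rank M.
Proof.
case=> sM' rM' [phi [inj_phi anti_phi im_phi]].
pose fl (H : hyperplane M) : flat M :=
  mk_flat (proj1 (andP (valP H))).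
have pt (H : hyperplane M) : exists p, val (phi (fl H)) == [set p].
  have : phi (fl H) \in [set P : flat M' | rk M' (val P) == 1].
    by rewrite -im_phi imset_f // inE; exact: (valP H).
  rewrite inE => /eqP /(simple_rk1_flat sM' (valP _)) [p eP].
  by exists p; apply/eqP.
(* [psi H] is the single element of the rank-1 flat that [phi] assigns to [H]; pulling [M'] back
   along it gives [N]. *)
pose psi H := xchoose (pt H).
have psiE H : val (phi (fl H)) = [set psi H] by apply/eqP/(xchooseP (pt H)).
have inj_psi : injective psi.
  move=> H1 H2 eH; apply: val_inj.
  suff /(congr1 val) : fl H1 = fl H2 by [].
  by apply/inj_phi/val_inj; rewrite !psiE eH.
exists (preim_matroid M' inj_psi); last first.
  by rewrite -rM' /rank rk_preim_matroid rk_leq_rank.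
apply/flat_matroidsP => e.
suff -> : hyperplanes_through M e
    = psi @^-1: val (phi (flat_cl M [set e])).
  by apply/preim_flat/valP.
apply/setP => H; rewrite !inE; apply/idP/idP => [eH | ].
  rewrite -sub1set -psiE anti_phi //=.
  apply: cl_sub_flat; last by rewrite sub1set.
  by have /andP [] := valP H.
(* Reflection of incidence is the case [J = set0] of [adjoint_point_notin]. *)
apply: contraLR => eH; rewrite -[[set e]]setU0.
apply: (adjoint_point_notin inj_phi rM' anti_phi (H := fl H)) => //.
- exact: (valP H).
- exact: indep0.
- exact: sub0set.
Qed.

(** As [mr] is an attained minimum, the inequality says that some member of [flat_matroids X] has
    rank at most [rank M]. *)
Lemma has_adjoint_mr : has_adjoint M <-> mr X <= rank M.
Proof.
rewrite /mr; case: ex_minnP => k /exists_inP [N NX /eqP rN] mink; split.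
  case=> E' [M' /adjoint_flat_matroid [N' N'X]]; apply: leq_trans.
  by apply: mink; apply/exists_inP; exists N'.
by rewrite -rN => le; exists (hyperplane M), N; apply: flat_matroid_adjoint.
Qed.

End FundamentalPattern.

Theorem theorem5p7 (E : finType) (M : matroid E) (X : pattern E (hyperplane M))
    (hX : tr_pattern X = fundamental_pattern M) :
  ~ has_adjoint M <-> mr X > tri X.
Proof.
rewrite (tri_fundamental hX) ltnNge; split.
  by move=> nadj; apply/negP => /(has_adjoint_mr hX).
by move=> /negP nle /(has_adjoint_mr hX).
Qed.
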